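(* Fix real numbers $a>b>0$ and an integer $k\ge 3$. For any $\nu\in\left(\frac{1}{2(k-1)},\frac1k\right)$ and any $\varepsilon>0$ there exist $\mu=\mu(\nu)$ and $c=c(\varepsilon)$ such that the following holds for $n$ large enough. Let $p=p(n)=\omega\, a/n$ and $q=q(n)=\omega\, b/n$ be such that $\omega>c$, and let $G\in\mathcal{G}(n,k,p,q)$ with planted partition $\mathcal{P}$. Then, with probability at least $1-\varepsilon$, for every $k$-part partition $\mathcal{A}$ of $[n]$ with $$q_{\mathcal{A}}(G)\ \ge\ \frac{a-b}{a+(k-1)b}\left(1-\frac1k-\frac{2}{k^2}\right)-\mu ,$$ either $d(\mathcal{A},\mathcal{P})\le\frac{1}{2(k-1)}$ or $d(\mathcal{A},\mathcal{P})\ge\nu$. Moreover, there are $k$-part partitions $\mathcal{A}$ satisfying the displayed inequality for which the latter alternative, $d(\mathcal{A},\mathcal{P})\ge\nu$, holds.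
   Context: Modularity: for a graph $G=(V,E)$ with $m=|E|\ge1$ edges and a partition $\mathcal{A}$ of $V$, $q_{\mathcal{A}}(G)=\sum_{A\in\mathcal{A}}\frac{e(A)}{m}-\sum_{A\in\mathcal{A}}\left(\frac{\mathrm{vol}(A)}{\mathrm{vol}(V)}\right)^2$, where $e(A)$ is the number of edges inside $A$ and $\mathrm{vol}(A)=\sum_{v\in A}d_v$ is the sum of degrees. Stochastic block model $\mathcal{G}(n,k,p,q)$: the vertex set $[n]$ is partitioned into $k$ communities $P_1,\dots,P_k$ with $\lfloor n/k\rfloor\le|P_i|\le\lceil n/k\rceil$ (the planted partition $\mathcal{P}=(P_i)_{i=1}^k$); independently for each pair of vertices, an edge is present with probability $p$ if both are in the same community and with probability $q$ otherwise. Here $k$ is fixed, $n\to\infty$, and $\omega=\omega(n)$ may depend on $n$. Distance: for a $k$-part partition $\mathcal{A}=(A_i)_{i=1}^k$, $d(\mathcal{A},\mathcal{P})=1-\frac1n\max_\sigma\sum_{i=1}^k|A_{\sigma(i)}\cap P_i|$, the maximum being over all permutations $\sigma$ of $[k]$. Convention: parts of a $k$-part partition may be empty, so a partition into fewer than $k$ parts is regarded as a $k$-part partition.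
   Formalization: Here c may depend on ν as well as ε: a c depending on ε alone is impossible, since for bounded ω a positive fraction of vertices is isolated, and moving those of one of two merged communities to an empty part keeps the modularity and gives a distance below ν for ν near 1/k. *)

(* Defs.v *)
From mathcomp Require Import all_boot all_order all_algebra all_fingroup.
From mathcomp Require Import reals.

Set Implicit Arguments.
Unset Strict Implicit.
Unset Printing Implicit Defensive.

Import Order.TTheory GRing.Theory Num.Theory.
Local Open Scope ring_scope.

(* Simple graphs on 'I_n: a graph is its edge set, an edge is a 2-subset. *)
Definition edge (n : nat) : finType := {e : {set 'I_n} | #|e| == 2%N}.
Definition graph (n : nat) : finType := {set edge n}.

(* A k-part partition (A_i)_(i < k), coded by the map sending a vertex to the
   index of its part; since the map need not be onto, parts may be empty. *)
Definition kpartition (n k : nat) : finType := {ffun 'I_n -> 'I_k}.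

Definition part (n k : nat) (A : kpartition n k) (i : 'I_k) : {set 'I_n} :=
  [set v | A v == i].

Definition deg (n : nat) (G : graph n) (v : 'I_n) : nat :=
  #|[set e in G | v \in val e]|.

Definition vol (n : nat) (G : graph n) (S : {set 'I_n}) : nat :=
  (\sum_(v in S) deg G v)%N.

Definition edges_in (n : nat) (G : graph n) (S : {set 'I_n}) : nat :=
  #|[set e in G | val e \subset S]|.

(* On the edgeless graph, division by zero gives modularity 0. *)
Definition modularity (R : realType) (n k : nat) (A : kpartition n k)
    (G : graph n) : R :=
  \sum_(i < k) (edges_in G (part A i))%:R / #|G|%:R
  - \sum_(i < k) ((vol G (part A i))%:R / (vol G [set: 'I_n])%:R) ^+ 2.

Definition dist (R : realType) (n k : nat) (A P : kpartition n k) : R :=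
  1 - n%:R^-1 *
    (\max_(s : {perm 'I_k}) \sum_(i < k) #|part A (s i) :&: part P i|)%N%:R.

(* floor (n/k) <= |P_i| <= ceil (n/k), for 0 < k. *)
Definition balanced (n k : nat) (P : kpartition n k) : bool :=
  [forall i : 'I_k, (n %/ k <= #|part P i| <= (n + k.-1) %/ k)%N].

Definition sbm_edge_prob (R : realType) (n k : nat) (P : kpartition n k)
    (p q : R) (e : edge n) : R :=
  if [exists i : 'I_k, val e \subset part P i] then p else q.

(* The probability of the single graph G under independent edges. *)
Definition sbm_weight (R : realType) (n k : nat) (P : kpartition n k)
    (p q : R) (G : graph n) : R :=
  \prod_(e : edge n)
    (if e \in G then sbm_edge_prob P p q e else 1 - sbm_edge_prob P p q e).

Definition sbm_prob (R : realType) (n k : nat) (P : kpartition n k)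
    (p q : R) (E : pred (graph n)) : R :=
  \sum_(G : graph n | E G) sbm_weight P p q G.

Lemma sbm_weight_ge0 (R : realType) (n k : nat) (P : kpartition n k)
    (p q : R) (G : graph n) :
  0 <= p <= 1 -> 0 <= q <= 1 -> 0 <= sbm_weight P p q G.
Proof.
move=> /andP[p0 p1] /andP[q0 q1]; apply: prodr_ge0 => e _.
by rewrite /sbm_edge_prob; do 2!case: ifP => _; rewrite ?subr_ge0.
Qed.

Lemma sbm_probT (R : realType) (n k : nat) (P : kpartition n k) (p q : R) :
  sbm_prob P p q predT = 1.
Proof.
transitivity (\prod_(e : edge n)
    (sbm_edge_prob P p q e + (1 - sbm_edge_prob P p q e))).
  by rewrite bigA_distr.
by apply: big1 => e _; rewrite addrC subrK.
Qed.

(* Main.v *)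
Require Import Defs.
From mathcomp Require Import all_boot all_order all_algebra all_fingroup.
From mathcomp Require Import reals sequences exp ring lra zify.

(** With high probability the modularity of [A] is nearly a deterministic function
of the overlaps of its parts with the planted communities.  Put
u_j(S) = |S :&: P_j| / |P_j|.  Under the block model the number of edges inside
a vertex set [S] has mean close to (omega n / 2) density(S), where
density(S) = ((a - b) sum_j u_j^2 + b (sum_j u_j)^2) / k^2.  The expected number
of edges is of order omega n, so by a Chernoff bound a deviation of order
omega n has probability at most exp(- C omega n).  There are only 2^n sets [S],
so for omega large the estimate holds for all of them at once
([density_concentration]).

The numbers e(S) determine the whole modularity, because
vol(S) = e(S) + |G| - e(complement of S) ([vol_edges_in]).  Hence for all
partitions simultaneously q_A(G) is close to [limit_modularity]
([modularity_approx]), which with u_ij = u_j(A_i) is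
((a - b) / (a + (k - 1) b)) f(u) with
f(u) = (k sum_ij u_ij^2 - sum_i (sum_j u_ij)^2) / k^2.

It remains to study f on column-stochastic matrices.  With D the total
off-diagonal mass, f(u) is largest, for given D <= 1, when a single community
loses the share D to a single part ([stochastic_loss]), which gives
k^2 f(u) <= k^2 - k - 2 (k D - (k - 1) D^2).  After relabelling the parts
optimally, D is close to k d(A, P) ([dist_share_perm]).  As
k D - (k - 1) D^2 - 1 = (1 - D) ((k - 1) D - 1), the value drops below
1 - 1/k - 2/k^2 as soon as 1/(k (k - 1)) < d < 1/k, and by a uniform amount for
1/(2 (k - 1)) < d < nu since k >= 3 ([limit_modularity_gap]).  This gap provides
mu.  Merging two planted communities gives exactly 1 - 1/k - 2/k^2 at distance
about 1/k > nu, hence the existence claim. *)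

Set Implicit Arguments.
Unset Strict Implicit.
Unset Printing Implicit Defensive.

Import Order.TTheory GRing.Theory Num.Theory.
Local Open Scope ring_scope.

(** * Exponential moments and large deviations *)

(** The inverse of [1 - x <= expR (- x)] and a geometric series; restricting to
[x <= 1 / 2] keeps the constant of the quadratic term explicit. *)
Lemma expR_le_quad (R : realType) (x : R) :
  x <= 1 / 2 -> expR x <= 1 + x + 2 * x ^+ 2.
Proof.
move=> x2; have x1 : 0 < 1 - x by lra.
have h : (1 - x)^-1 <= 1 + x + 2 * x ^+ 2.
  rewrite -div1r ler_pdivrMr //.
  have : 0 <= x ^+ 2 * (1 - 2 * x) by apply: mulr_ge0; [exact: sqr_ge0 | lra].
  by rewrite expr2; nra.
apply: le_trans h; rewrite -[leLHS]invrK -expRN lef_pV2 ?posrE ?expR_gt0 //.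
exact: (expR_ge1Dx (- x)).
Qed.

Section Concentration.
Variables (R : realType) (n k : nat) (P : kpartition n k) (p q : R).
Hypotheses (p01 : 0 <= p <= 1) (q01 : 0 <= q <= 1).

Let pr := sbm_edge_prob P p q.

Definition mean_edges (B : {set edge n}) : R :=
  \sum_(e in B) sbm_edge_prob P p q e.

Lemma sbm_edge_prob01 e : 0 <= pr e <= 1.
Proof. by rewrite /pr /sbm_edge_prob; case: ifP. Qed.

(** The edges are independent, so the moment generating function factors, and a
centred Bernoulli variable of mean [p] has exponential moment at most
[expR (2 * l ^+ 2 * p)].  Keeping the variance proxy proportional to the mean,
rather than to the number of pairs, is what makes the bound useful for sparse
graphs. *)
Lemma sbm_mgf (B : {set edge n}) (l : R) : l <= 1 / 2 ->
  \sum_(G : graph n) sbm_weight P p q G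
      * expR (l * (#|G :&: B|%:R - mean_edges B))
    <= expR (2 * l ^+ 2 * mean_edges B).
Proof.
move=> l2.
have -> : \sum_(G : graph n) sbm_weight P p q G
      * expR (l * (#|G :&: B|%:R - mean_edges B)) =
  \prod_(e : edge n) (pr e * (if e \in B then expR (l * (1 - pr e)) else 1)
     + (1 - pr e) * (if e \in B then expR (l * (0 - pr e)) else 1)).
  rewrite bigA_distr; apply: eq_bigr => G _.
  have -> : l * (#|G :&: B|%:R - mean_edges B)
     = \sum_e (if e \in B then l * ((e \in G)%:R - pr e) else 0).
    rewrite -big_mkcond /= -mulr_sumr sumrB; congr (_ * (_ - _)).
    rewrite -sum1_card natr_sum big_mkcond [in RHS]big_mkcond.
    by apply: eq_bigr => e _; rewrite inE; do 2!case: (e \in _).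
  rewrite expR_sum -big_split; apply: eq_bigr => e _ /=.
  by rewrite -/pr; do 2!case: ifP => _; rewrite ?expR0.
rewrite /mean_edges mulr_sumr [in leRHS]big_mkcond expR_sum.
apply: ler_prod => e _; have /andP[e0 e1] := sbm_edge_prob01 e.
have e1' : 0 <= 1 - pr e by rewrite subr_ge0.
case: ifP => _; last by rewrite expR0 !mulr1 addrC subrK ler01 lexx.
apply/andP; split; first by rewrite addr_ge0 ?mulr_ge0 ?expR_ge0.
rewrite !mulrBr mulr0 mulr1 !expRD expR0.
rewrite mul1r mulrA -mulrDl.
have h : pr e * expR l + (1 - pr e) <= expR (pr e * (l + 2 * l ^+ 2)).
  apply: le_trans (expR_ge1Dx _).
  have := ler_wpM2l e0 (expR_le_quad l2).
  by lra.
apply: le_trans (ler_wpM2r (expR_ge0 _) h) _.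
by rewrite -expRD ler_expR -/pr; lra.
Qed.

End Concentration.

Definition inner (n : nat) (S : {set 'I_n}) : {set edge n} :=
  [set e : edge n | val e \subset S].

Lemma edges_inE n (G : graph n) S : edges_in G S = #|G :&: inner S|.
Proof. by congr #|pred_of_set _|; apply/setP => e; rewrite !inE. Qed.

Section Tail.
Variables (R : realType) (n k : nat) (P : kpartition n k) (p q : R).
Hypotheses (p01 : 0 <= p <= 1) (q01 : 0 <= q <= 1).

Lemma sbm_prob_le (E F : pred (graph n)) : {subset E <= F} ->
  sbm_prob P p q E <= sbm_prob P p q F.
Proof.
move=> EF; rewrite /sbm_prob big_mkcond [leRHS]big_mkcond.
apply: ler_sum => G _; have := EF G; rewrite -!topredE /=.
case: (E G) => [-> // | _]; case: (F G) => //; exact: sbm_weight_ge0.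
Qed.

(** Markov's inequality for the exponential moment.  The sign of [l] is free, so
both tails are covered. *)
Lemma sbm_chernoff (B : {set edge n}) (l s : R) : l <= 1 / 2 ->
  sbm_prob P p q (fun G => s <= l * (#|G :&: B|%:R - mean_edges P p q B))
    <= expR (2 * l ^+ 2 * mean_edges P p q B - s).
Proof.
move=> l2; rewrite expRD expRN ler_pdivlMr ?expR_gt0 //.
apply: le_trans (sbm_mgf P p01 q01 B l2).
rewrite /sbm_prob mulr_suml big_mkcond; apply: ler_sum => G _.
have w0 := sbm_weight_ge0 P G p01 q01.
case: ifP => h; last by rewrite mulr_ge0 ?expR_ge0.
by rewrite ler_wpM2l // ler_expR.
Qed.

(** A union bound over the [2 ^+ n] vertex sets and the two tails. *)
Lemma edges_in_concentration (M t l : R) :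
  (forall B, mean_edges P p q B <= M) -> 0 <= l <= 1 / 2 ->
  1 - 2 ^+ n * (2 * expR (2 * l ^+ 2 * M - l * t)) <=
  sbm_prob P p q (fun G => [forall S : {set 'I_n},
    `|(edges_in G S)%:R - mean_edges P p q (inner S)| <= t]).
Proof.
move=> HM /andP[l0 l2]; rewrite lerBlDr -[leLHS](sbm_probT P p q).
set good := fun G : graph n => _.
rewrite /sbm_prob (bigID good) /= lerD2l.
pose dev S (G : graph n) : R := #|G :&: inner S|%:R - mean_edges P p q (inner S).
apply: (@le_trans _ _ (\sum_(S : {set 'I_n})
   (sbm_prob P p q (fun G => l * t <= l * dev S G)
  + sbm_prob P p q (fun G => l * t <= (- l) * dev S G)))); last first.
  have -> : 2 ^+ n * (2 * expR (2 * l ^+ 2 * M - l * t)) =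
    \sum_(S : {set 'I_n}) (2 * expR (2 * l ^+ 2 * M - l * t)).
    have cs : #|{set 'I_n}| = (2 ^ n)%N.
      by rewrite -cardsT -powersetT card_powerset cardsT card_ord.
    by rewrite sumr_const cs -[RHS]mulr_natl natrX.
  apply: ler_sum => S _; rewrite mulr_natl mulr2n.
  apply: lerD; apply: le_trans (sbm_chernoff _ _ _) _ => //; try lra;
    rewrite ler_expR ?sqrrN lerD2r ler_wpM2l // mulr_ge0 ?sqr_ge0 //.
under [leRHS]eq_bigr do rewrite /sbm_prob [X in X + _]big_mkcond
   [X in _ + X]big_mkcond -big_split /=.
rewrite exchange_big /= big_mkcond; apply: ler_sum => G _.
have w0 := sbm_weight_ge0 P G p01 q01.
have pos S : 0 <= (if l * t <= l * dev S G then sbm_weight P p q G else 0)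
       + (if l * t <= - l * dev S G then sbm_weight P p q G else 0).
  by apply: addr_ge0; case: ifP.
case: ifP => [/forallPn[S]|_]; last exact: sumr_ge0.
rewrite -ltNge edges_inE -/(dev S G) => hS.
rewrite (bigD1 S) //= -[leLHS]addr0 lerD ?sumr_ge0 //.
move: hS; rewrite lter_normr => /orP[] h.
  by rewrite ler_wpM2l ?(ltW h) // lerDl; case: ifP.
have {}h : l * t <= - l * dev S G by rewrite mulNr -mulrN ler_wpM2l // ltW.
by rewrite h lerDr; case: ifP.
Qed.

End Tail.

(** * Mean number of edges inside a vertex set *)

Lemma card_inner n (S : {set 'I_n}) : #|inner S| = 'C(#|S|, 2).
Proof.
rewrite -cards_draws -(card_imset _ val_inj) /=; apply: eq_card => A.
rewrite [in RHS]inE; apply/imsetP/andP => [[e eS ->]|[AS A2]].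
  by move: eS; rewrite inE => ->; split=> //; apply: (valP e).
by exists (exist _ A A2); rewrite ?inE.
Qed.

Lemma natr_bin2 (R : realType) m : 'C(m, 2)%:R = m%:R * (m%:R - 1) / 2 :> R.
Proof.
apply: (@mulIf R 2); first by rewrite pnatr_eq0.
rewrite mulfVK ?pnatr_eq0 // -natrM.
case: m => [|m]; first by rewrite mul0r.
by rewrite mulnC -mul_bin_diag bin1 natrM -natr1 addrK.
Qed.

(** An edge probability is [q], plus [p - q] when the edge lies inside some
community; as an edge is nonempty, this community is unique and its indicator
is the sum of the indicators over all communities. *)
Lemma mean_inner (R : realType) n k (P : kpartition n k) (p q : R) S :
  mean_edges P p q (inner S) =
  q * 'C(#|S|, 2)%:R + (p - q) * \sum_(j < k) 'C(#|S :&: part P j|, 2)%:R.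
Proof.
have one e : sbm_edge_prob P p q e =
    q + (p - q) * \sum_(j < k) (e \in inner (part P j))%:R.
  rewrite /sbm_edge_prob; case: ifP => [/existsP[i ei]|/negbT/existsPn ne].
    rewrite (bigD1 i) //= inE ei big1 ?addr0 ?mulr1 1?addrC ?subrK //.
    move=> j ji; rewrite inE; case: (boolP (_ \subset _)) => // ej.
    have /card_gt0P[v ve] : (0 < #|val e|)%N by rewrite (eqP (valP e)).
    move/subsetP/(_ v ve): ei; move/subsetP/(_ v ve): ej; rewrite !inE.
    by move=> /eqP -> /eqP h; rewrite h eqxx in ji.
  by rewrite big1 ?mulr0 ?addr0 // => j _; rewrite inE (negbTE (ne j)).
rewrite /mean_edges (eq_bigr _ (fun e _ => one e)) big_split /=.
rewrite sumr_const card_inner mulr_natr -mulr_sumr exchange_big /=.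
congr (_ + _ * _); apply: eq_bigr => j _.
rewrite -card_inner -sum1_card natr_sum big_mkcond [RHS]big_mkcond.
by apply: eq_bigr => e _; rewrite !inE subsetI; do 2!case: (_ \subset _).
Qed.

(** * The limit of the modularity *)

(** Recovers volumes from edge counts: an edge meets [S] in two points, one or
none, and each case contributes equally to both sides.  Controlling the numbers
of edges inside all sets therefore controls the whole modularity. *)
Lemma vol_edges_in n (G : graph n) (S : {set 'I_n}) :
  (vol G S + edges_in G (~: S) = edges_in G S + #|G|)%N.
Proof.
have cardE (p : pred (edge n)) : #|[set e in G | p e]| = (\sum_(e in G) p e)%N.
  by rewrite -sum1_card big_mkcond [RHS]big_mkcond; apply: eq_bigr => e _;
     rewrite inE; case: (e \in G) => //=; case: (p e).
rewrite /vol /edges_in !cardE /deg.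
under eq_bigr do rewrite cardE.
rewrite exchange_big -sum1_card -!big_split /=; apply: eq_bigr => e _.
have -> : (\sum_(v in S) (v \in val e) = #|val e :&: S|)%N.
  rewrite -sum1_card big_mkcond [RHS]big_mkcond; apply: eq_bigr => v _.
  by rewrite inE; do 2!case: (v \in _).
have e2 : #|val e| = 2%N := eqP (valP e).
have := cardsID S (val e); rewrite e2.
have -> : (val e \subset ~: S) = (#|val e :&: S| == 0%N).
  by rewrite cards_eq0 setI_eq0 disjoints_subset.
have -> : (val e \subset S) = (#|val e :\: S| == 0%N).
  by rewrite cards_eq0 setD_eq0.
by case: #|_ :&: _| => [|[|[|x]]]; case: #|_ :\: _| => [|[|[|y]]].
Qed.

(** Stability of a quotient; it serves for the edge fractions and for the volume
fractions, whose common denominator is the normalized edge count. *)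
Lemma ratio_approx (R : realType) (x y m c r s : R) :
  0 < c -> 0 <= y <= 1 -> `|x - y * c| <= s -> `|m - c| <= r -> r <= c / 2 ->
  `|x / m - y| <= 2 * (s + r) / c.
Proof.
move=> c0 /andP[y0 y1]; rewrite !ler_distl => /andP[x1 x2] /andP[m1 m2] rc.
have m0 : 0 < m by lra.
have mc : c / 2 <= m by lra.
have -> : 2 * (s + r) / c = (s + r) / (c / 2) by field; rewrite gt_eqF.
have sr0 : 0 <= s + r by lra.
have h : (s + r) / m <= (s + r) / (c / 2).
  by rewrite ler_wpM2l // lef_pV2 ?posrE //; lra.
have yr : y * (m - c) <= r /\ - r <= y * (m - c) by split; nra.
have mn0 : m != 0 by rewrite gt_eqF.
have h1 : x / m <= y + (s + r) / m.
  by rewrite ler_pdivrMr // mulrDl mulfVK //; lra.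
have h2 : y - (s + r) / m <= x / m.
  by rewrite ler_pdivlMr // mulrBl mulfVK //; lra.
by apply/andP; split; lra.
Qed.

Lemma edges_inT n (G : graph n) : edges_in G [set: 'I_n] = #|G|.
Proof. by apply: eq_card => e; rewrite inE subsetT andbT. Qed.

Lemma edges_in0 n (G : graph n) : edges_in G set0 = 0%N.
Proof.
apply: eq_card0 => e; rewrite inE subset0; apply/negbTE/nandP; right.
by rewrite -cards_eq0 (eqP (valP e)).
Qed.

Section Limit.
Variables (R : realType) (n k : nat) (P : kpartition n k) (a b : R).

Definition share (S : {set 'I_n}) (j : 'I_k) : R :=
  #|S :&: part P j|%:R / #|part P j|%:R.

(** The limit of [2 e(S) / (omega n)].  It is written with the shares of the
communities rather than with cardinals over [n], so that the identities
[densityT] and [density_vol] hold exactly even when the communities differ in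
size by one. *)
Definition density (S : {set 'I_n}) : R :=
  ((a - b) * \sum_j share S j ^+ 2 + b * (\sum_j share S j) ^+ 2) / k%:R ^+ 2.

(** The modularity computed from limiting densities: the contribution of [b] to the
edge terms combines with the volume terms into the single subtracted sum. *)
Definition limit_modularity (A : kpartition n k) : R :=
  (a - b) / (a + (k%:R - 1) * b) *
  ((k%:R * (\sum_i \sum_j share (part A i) j ^+ 2)
    - \sum_i (\sum_j share (part A i) j) ^+ 2) / k%:R ^+ 2).

Hypotheses (b0 : 0 < b) (ab : b < a) (k0 : (0 < k)%N).
Hypothesis P0 : forall j, (0 < #|part P j|)%N.

Let P0' j : (#|part P j|%:R : R) != 0.
Proof. by rewrite pnatr_eq0 -lt0n. Qed.

Lemma share_ge0 S j : 0 <= share S j.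
Proof. by rewrite divr_ge0. Qed.

Lemma share_le1 S j : share S j <= 1.
Proof.
by rewrite ler_pdivrMr ?ltr0n // mul1r ler_nat subset_leq_card // subsetIr.
Qed.

Lemma shareT j : share [set: 'I_n] j = 1.
Proof. by rewrite /share setTI divff. Qed.

Lemma shareC S j : share (~: S) j = 1 - share S j.
Proof.
apply: (@mulIf _ _ (P0' j)).
rewrite /share mulrBl !mulfVK // mul1r -(cardsID S (part P j)) natrD.
by rewrite ![part P j :&: _]setIC [S :&: _]setIC setIC addrC addKr setDE setIC.
Qed.

Lemma sum_share (A : kpartition n k) j : \sum_i share (part A i) j = 1.
Proof.
rewrite /share -mulr_suml -natr_sum -[RHS](divff (P0' j)); congr (_%:R / _).
rewrite -sum1_card (partition_big A xpredT) //=; apply: eq_bigr => i _.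
by rewrite -sum1_card; apply: eq_bigl => v; rewrite !inE andbC.
Qed.

Let kappa := (a + (k%:R - 1) * b) / k%:R.

Let k1 : 1 <= k%:R :> R. Proof. by rewrite ler1n. Qed.

Lemma kappa_gt0 : 0 < kappa.
Proof. by rewrite divr_gt0 ?ltr0n // ltr_pwDl ?(lt_trans b0) ?mulr_ge0 ?subr_ge0 ?k1 ?(ltW b0). Qed.

Lemma densityT : density [set: 'I_n] = kappa.
Proof.
rewrite /density; under eq_bigr do rewrite shareT expr1n.
under [X in _ + _ * X ^+ 2]eq_bigr do rewrite shareT.
by rewrite sumr_const card_ord /kappa; field; rewrite pnatr_eq0 -lt0n.
Qed.

Lemma density_bound S : 0 <= density S / kappa <= 1.
Proof.
have K := kappa_gt0.
have s0 : 0 <= \sum_j share S j by apply: sumr_ge0 => j _; exact: share_ge0.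
apply/andP; split.
  apply: divr_ge0; last exact: ltW.
  apply: divr_ge0; last exact: sqr_ge0.
  apply: addr_ge0; apply: mulr_ge0; rewrite ?sqr_ge0 ?subr_ge0 ?(ltW b0) ?(ltW ab) //.
  by apply: sumr_ge0 => j _; exact: sqr_ge0.
rewrite ler_pdivrMr // mul1r -densityT.
rewrite ler_wpM2r ?invr_ge0 ?sqr_ge0 // lerD // ler_wpM2l ?subr_ge0 ?(ltW ab) ?(ltW b0) //.
  apply: ler_sum => j _; rewrite shareT lerXn2r ?nnegrE ?share_ge0 ?ler01 //.
  exact: share_le1.
rewrite lerXn2r ?nnegrE //; first by rewrite sumr_ge0 // => j _; exact: share_ge0.
by apply: ler_sum => j _; rewrite shareT share_le1.
Qed.

(** The density counterpart of [vol_edges_in]: in the limit all degrees are equal,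
so a volume is proportional to the average share. *)
Lemma density_vol S :
  density S + density [set: 'I_n] - density (~: S)
    = 2 * ((\sum_j share S j) / k%:R * kappa).
Proof.
rewrite densityT /density.
have -> : \sum_j share (~: S) j ^+ 2 = k%:R - 2 * (\sum_j share S j) + \sum_j share S j ^+ 2.
  have -> : \sum_j share (~: S) j ^+ 2 = \sum_j (1 - 2 * share S j + share S j ^+ 2).
    by apply: eq_bigr => j _; rewrite shareC; ring.
  by rewrite !big_split /= sumr_const card_ord sumrN -mulr_sumr.
have -> : \sum_j share (~: S) j = k%:R - \sum_j share S j.
  by under eq_bigr do rewrite shareC; rewrite sumrB sumr_const card_ord.
by rewrite /kappa; field; rewrite pnatr_eq0 -lt0n.
Qed.

(** All the modularities are governed by the edge densities of vertex sets, hence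
a uniform estimate of the latter bounds the error for every partition at once. *)
Lemma modularity_approx (G : graph n) (A : kpartition n k) (N r : R) :
  0 < N -> r <= kappa / 2 ->
  (forall S, `|2 * (edges_in G S)%:R / N - density S| <= r) ->
  `|modularity R A G - limit_modularity A| <= k%:R * (29 * r / kappa).
Proof.
move=> N0 rk close; have K := kappa_gt0.
pose E S := 2 * (edges_in G S)%:R / N.
have cl S : `|E S - density S| <= r by exact: close.
have clT : `|E setT - kappa| <= r by rewrite -densityT.
have r0 : 0 <= r by apply: le_trans clT.
have ET0 : 0 < E setT by move: clT; rewrite ler_distl => /andP[]; lra.
have g0 : (#|G|%:R : R) != 0.
  by apply: contraTneq ET0 => g; rewrite /E edges_inT g mulr0 mul0r ltxx.
have Nn0 : N != 0 by rewrite gt_eqF.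
have volE S : (vol G S)%:R / N = (E S + E setT - E (~: S)) / 2.
  have := congr1 (fun m => m%:R : R) (vol_edges_in G S).
  rewrite /= !natrD /E edges_inT => /(canRL (addrK _)) ->.
  by field.
have volT : (vol G [set: 'I_n])%:R = 2 * #|G|%:R :> R.
  have := vol_edges_in G [set: 'I_n].
  by rewrite setCT edges_in0 addn0 edges_inT => ->; rewrite natrD; ring.
pose al i := (\sum_j share (part A i) j) / k%:R.
have al01 i : 0 <= al i <= 1.
  rewrite /al; apply/andP; split.
    by rewrite divr_ge0 ?sumr_ge0 // => j _; exact: share_ge0.
  rewrite ler_pdivrMr ?ltr0n // mul1r.
  apply: le_trans (_ : \sum_(j < k) 1 <= _); last by rewrite sumr_const card_ord.
  by apply: ler_sum => j _; exact: share_le1.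
have -> : modularity R A G =
  \sum_i (E (part A i) / E setT - ((vol G (part A i))%:R / N / E setT) ^+ 2).
  rewrite sumrB; congr (_ - _); apply: eq_bigr => i _.
    by rewrite /E edges_inT; field; rewrite Nn0.
  by rewrite volT /E edges_inT; congr (_ ^+ 2); field; rewrite Nn0.
have -> : limit_modularity A = \sum_i (density (part A i) / kappa - al i ^+ 2).
  rewrite /limit_modularity sumrB -mulr_suml /density -mulr_suml big_split /=.
  rewrite -!mulr_sumr /al.
  under [X in _ = _ - X]eq_bigr do rewrite expr_div_n.
  rewrite -mulr_suml /kappa; field.
  rewrite pnatr_eq0 -lt0n k0 /= gt_eqF //.
  by have := K; rewrite /kappa pmulr_lgt0 // invr_gt0 ltr0n.
rewrite -sumrB.
apply: le_trans (ler_norm_sum _ _ _) _.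
rewrite -[leRHS](_ : \sum_(i < k) (29 * r / kappa) = _); last first.
  by rewrite sumr_const card_ord -[LHS]mulr_natl.
apply: ler_sum => i _.
(* The edge terms cost [4 r / kappa] and the squared volume terms [25 r / kappa]. *)
have h1 : `|E (part A i) / E setT - density (part A i) / kappa| <= 2 * (r + r) / kappa.
  apply: ratio_approx => //; first exact: density_bound.
  by rewrite mulfVK ?gt_eqF.
have h2 : `|(vol G (part A i))%:R / N / E setT - al i| <= 2 * (3 / 2 * r + r) / kappa.
  apply: ratio_approx => //.
  have := density_vol (part A i); rewrite -/(al i) => dv.
  move: (cl (part A i)) (cl (~: part A i)) (cl setT); rewrite !ler_distl volE.
  by move=> /andP[? ?] /andP[? ?] /andP[? ?]; apply/andP; split; lra.
move: h1 h2; set x := E _ / _; set y := density _ / _; set z := _ / E _.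
set w := r / kappa.
have -> : 2 * (r + r) / kappa = 4 * w by rewrite /w; field; rewrite gt_eqF.
have -> : 2 * (3 / 2 * r + r) / kappa = 5 * w by rewrite /w; field; rewrite gt_eqF.
have -> : 29 * r / kappa = 29 * w by rewrite /w mulrA.
have w0 : 0 <= w by rewrite divr_ge0 // ltW.
have w2 : w <= 1 / 2 by rewrite /w ler_pdivrMr //; lra.
have /andP[a0 a1] := al01 i; move: (al i) a0 a1 => t t0 t1.
rewrite !ler_distl => /andP[x1 x2] /andP[z1 z2].
have : z ^+ 2 - t ^+ 2 <= 25 * w /\ - (25 * w) <= z ^+ 2 - t ^+ 2.
  have -> : z ^+ 2 - t ^+ 2 = (z - t) * (z + t) by ring.
  have zt : `|z - t| <= 5 * w by rewrite ler_distl; lra.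
  have zt' : `|z + t| <= 5 by rewrite ler_norml; lra.
  have : `|(z - t) * (z + t)| <= 25 * w.
    rewrite normrM; apply: le_trans (ler_pM _ _ zt zt') _ => //; lra.
  by rewrite ler_norml => /andP[].
by move=> [? ?]; apply/andP; split; lra.
Qed.

End Limit.

(** * Balanced planted partitions *)

Section Balanced.
Variables (R : realType) (n k : nat) (P : kpartition n k).
Hypotheses (k0 : (0 < k)%N) (kn : (k <= n)%N) (bP : balanced P).

Lemma sum_cap_part (S : {set 'I_n}) : (\sum_j #|S :&: part P j|)%N = #|S|.
Proof.
rewrite -[RHS]sum1_card (partition_big P xpredT) //=; apply: eq_bigr => i _.
by rewrite -sum1_card; apply: eq_bigl => v; rewrite !inE.
Qed.

Lemma sum_part : (\sum_j #|part P j|)%N = n.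
Proof.
rewrite -[RHS]card_ord -cardsT -sum_cap_part.
by apply: eq_bigr => j _; rewrite setTI.
Qed.

Lemma balanced_gt0 j : (0 < #|part P j|)%N.
Proof.
have /forallP/(_ j)/andP[+ _] := bP; apply: leq_trans.
by rewrite divn_gt0.
Qed.

Lemma balanced_size j : `|#|part P j|%:R - n%:R / k%:R| <= 1 :> R.
Proof.
have /forallP/(_ j)/andP[h1 h2] := bP.
have {}h1 : (n <= #|part P j| * k + k)%N.
  apply: leq_trans (ltnW (ltn_ceil n k0)) _.
  by rewrite mulSnr leq_add2r leq_mul2r h1 orbT.
have {}h2 : (#|part P j| * k <= n + k)%N.
  apply: leq_trans (leq_trans (_ : _ <= ((n + k.-1) %/ k) * k)%N (leq_trunc_div _ _)) _.
    by rewrite leq_mul2r h2 orbT.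
  by rewrite leq_add2l leq_pred.
have kp : 0 < k%:R :> R by rewrite ltr0n.
move: h1 h2; rewrite -!(ler_nat R) !natrD !natrM ler_distl => h1 h2.
apply/andP; split.
  by rewrite lerBlDr ler_pdivrMr //; lra.
by rewrite -lerBlDr ler_pdivlMr //; lra.
Qed.

Lemma balanced_ratio j : `|#|part P j|%:R / n%:R - 1 / k%:R| <= 1 / n%:R :> R.
Proof.
have n0 : 0 < n%:R :> R by rewrite ltr0n (leq_trans k0).
have kp : 0 < k%:R :> R by rewrite ltr0n.
have -> : #|part P j|%:R / n%:R - 1 / k%:R =
   (#|part P j|%:R - n%:R / k%:R) / n%:R :> R.
  by field; rewrite !gt_eqF.
by rewrite normrM [X in _ * X]ger0_norm ?invr_ge0 ?(ltW n0) // ler_pM2r ?invr_gt0 // balanced_size.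
Qed.

(** Replacing [m (m - 1)] by [m ^+ 2] in the binomial coefficients and [|P_j|] by
[n / k] both cost an error of order [1 / n]. *)
Lemma mean_inner_density (a b w : R) (S : {set 'I_n}) : 0 < b -> b < a -> 0 < w ->
  `|2 * mean_edges P (w * a / n%:R) (w * b / n%:R) (inner S) / (w * n%:R)
    - density P a b S| <= (2 * k%:R + 1) * a / n%:R.
Proof.
move=> b0 ab w0.
have n0 : 0 < n%:R :> R by rewrite ltr0n (leq_trans k0).
have kp : 0 < k%:R :> R by rewrite ltr0n.
pose x j : R := #|S :&: part P j|%:R / n%:R.
pose y j : R := share R P S j / k%:R.
set h : R := 1 / n%:R.
have Sx : #|S|%:R = n%:R * \sum_j x j.
  by rewrite -mulr_suml mulrC mulfVK ?gt_eqF // -natr_sum sum_cap_part.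
have x0 j : 0 <= x j by rewrite divr_ge0.
have y0 j : 0 <= y j by rewrite divr_ge0 ?share_ge0.
have Sx1 : \sum_j x j <= 1.
  rewrite -(ler_pM2l n0) -Sx mulr1 ler_nat -[leqRHS]card_ord.
  exact: max_card.
have x1 j : x j <= 1.
  by apply: le_trans Sx1; rewrite (bigD1 j) //= lerDl sumr_ge0.
have Sy1 : \sum_j y j <= 1.
  rewrite -mulr_suml ler_pdivrMr // mul1r.
  apply: le_trans (_ : \sum_(j < k) 1 <= _); last by rewrite sumr_const card_ord.
  by apply: ler_sum => j _; exact: share_le1 balanced_gt0 _ _.
have y1 j : y j <= 1.
  by apply: le_trans Sy1; rewrite (bigD1 j) //= lerDl sumr_ge0.
have xy j : `|x j - y j| <= h.
  have u0 := share_ge0 R P S j.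
  have u1 : share R P S j <= 1 by exact: share_le1 balanced_gt0 _ _.
  have -> : x j - y j = share R P S j * (#|part P j|%:R / n%:R - 1 / k%:R).
    rewrite /x /y /share; field.
    by rewrite !gt_eqF //= ltr0n balanced_gt0.
  rewrite normrM ger0_norm // -[leRHS]mul1r ler_pM //.
  exact: balanced_ratio.
have h0 : 0 <= h by rewrite divr_ge0.
have sq (s t : R) (d : R) : 0 <= s <= 1 -> 0 <= t <= 1 -> `|s - t| <= d ->
   `|s ^+ 2 - t ^+ 2| <= 2 * d.
  move=> /andP[s0 s1] /andP[t0 t1] st; rewrite subr_sqr normrM mulrC ler_pM //.
  by rewrite ger0_norm; lra.
have h1 : `|\sum_j x j ^+ 2 - \sum_j y j ^+ 2| <= k%:R * (2 * h).
  rewrite -sumrB; apply: le_trans (ler_norm_sum _ _ _) _.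
  apply: le_trans (_ : \sum_(j < k) (2 * h) <= _); last first.
    by rewrite sumr_const card_ord -[leLHS]mulr_natl.
  by apply: ler_sum => j _; apply: sq; rewrite ?x0 ?y0 ?x1 ?y1.
have h2 : `|(\sum_j x j) ^+ 2 - (\sum_j y j) ^+ 2| <= 2 * (k%:R * h).
  apply: sq; rewrite ?sumr_ge0 ?Sx1 ?Sy1 //.
  rewrite -sumrB; apply: le_trans (ler_norm_sum _ _ _) _.
  apply: le_trans (_ : \sum_(j < k) h <= _); last first.
    by rewrite sumr_const card_ord -[leLHS]mulr_natl.
  by apply: ler_sum => j _.
have -> : density P a b S = (a - b) * (\sum_j y j ^+ 2) + b * (\sum_j y j) ^+ 2.
  rewrite /density -mulr_suml; under [in RHS]eq_bigr do rewrite expr_div_n.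
  by rewrite -mulr_suml; field; rewrite gt_eqF.
have -> : 2 * mean_edges P (w * a / n%:R) (w * b / n%:R) (inner S) / (w * n%:R)
  = (a - b) * (\sum_j x j ^+ 2) + b * (\sum_j x j) ^+ 2 - a * (\sum_j x j) * h.
  rewrite mean_inner natr_bin2 Sx.
  have -> : \sum_j 'C(#|S :&: part P j|, 2)%:R =
     (n%:R ^+ 2 * \sum_j x j ^+ 2 - n%:R * \sum_j x j) / 2 :> R.
    rewrite !mulr_sumr -sumrB mulr_suml; apply: eq_bigr => j _.
    by rewrite natr_bin2 /x; field; rewrite gt_eqF.
  by rewrite /h; field; rewrite !gt_eqF.
have -> : (2 * k%:R + 1) * a / n%:R = (2 * k%:R + 1) * a * h by rewrite /h mul1r.
have X0 : 0 <= \sum_j x j by rewrite sumr_ge0.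
move: h1 h2; rewrite !ler_distl => /andP[h1 h1'] /andP[h2 h2'].
have ab0 : 0 <= a - b by lra.
have := ler_wpM2l ab0 h1; have := ler_wpM2l ab0 h1'.
have := ler_wpM2l (ltW b0) h2; have := ler_wpM2l (ltW b0) h2'.
have ah : 0 <= a * h by rewrite mulr_ge0 //; lra.
have : 0 <= a * h * \sum_j x j by rewrite mulr_ge0.
have := ler_wpM2l ah Sx1.
by move=> e1 e2 e3 e4 e5 e6; apply/andP; split; lra.
Qed.

End Balanced.

(** * Uniform concentration of the edge densities *)

Lemma eventually_ge (R : realType) (X : R) :
  exists n0 : nat, forall n : nat, (n0 <= n)%N -> X <= n%:R.
Proof.
exists (Num.bound `|X|) => n; rewrite -(ler_nat R); apply: le_trans.
exact: le_trans (ler_norm X) (ltW (archi_boundP (normr_ge0 X))).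
Qed.

(** The union bound over [2 ^+ n] sets is paid for by half of the exponent, since
[2 <= expR 1]. *)
Lemma expR_decay (R : realType) (n : nat) :
  2 ^+ n * (2 * expR (- (2 * n%:R))) <= 2 / (1 + n%:R) :> R.
Proof.
have -> : - (2 * n%:R) = - n%:R - n%:R :> R by lra.
rewrite expRD mulrCA ler_pM2l // mulrA.
have e0 : 0 < expR n%:R :> R by exact: expR_gt0.
have h1 : 2 ^+ n * expR (- n%:R) <= 1 :> R.
  rewrite expRN ler_pdivrMr // mul1r -[n%:R]mulr1 expRM_natl.
  apply: lerXn2r; rewrite ?nnegrE ?expR_ge0 //.
  by have := expR_ge1Dx (1 : R); lra.
have h2 : expR (- n%:R) <= (1 + n%:R)^-1 :> R.
  by rewrite expRN lef_pV2 ?posrE ?expR_ge1Dx // ltr_pwDl.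
by rewrite -[leRHS]mul1r ler_pM // ?mulr_ge0 ?exprn_ge0 ?expR_ge0.
Qed.

(** The deviation [r omega n / 4] has probability at most
[expR (- r ^+ 2 omega n / (64 a))], which beats the number of vertex sets once
[omega] exceeds a constant multiple of [a / r ^+ 2]; the remaining factor
[expR (- n)] is then below [eps] for large [n]. *)
Lemma density_concentration (R : realType) (a b : R) (k : nat) (r eps : R) :
  0 < b -> b < a -> (0 < k)%N -> 0 < r -> r <= a -> 0 < eps ->
  exists c : R, 0 < c /\
  exists n0 : nat, forall n : nat, (n0 <= n)%N ->
  forall w : R, c < w -> w * a / n%:R <= 1 ->
  forall P : kpartition n k, balanced P ->
  1 - eps <= sbm_prob P (w * a / n%:R) (w * b / n%:R) (fun G : graph n =>
    [forall S, `|2 * (edges_in G S)%:R / (w * n%:R) - density P a b S| <= r]).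
Proof.
move=> b0 ab k0 r0 ra eps0.
have a0 : 0 < a by lra.
exists (128 * a / r ^+ 2); split; first by rewrite divr_gt0 ?mulr_gt0 ?exprn_gt0.
have [n1 h1] := eventually_ge ((2 * k%:R + 1) * a * 2 / r).
have [n2 h2] := eventually_ge (2 / eps).
exists (k + n1 + n2)%N => n hn w wc wa P bP.
have kn : (k <= n)%N by lia.
have {}h1 : (2 * k%:R + 1) * a * 2 / r <= n%:R by apply: h1; lia.
have {}h2 : 2 / eps <= n%:R by apply: h2; lia.
have w0 : 0 < w by apply: lt_trans wc; rewrite divr_gt0 ?mulr_gt0 ?exprn_gt0.
have n0 : 0 < n%:R :> R by rewrite ltr0n (leq_trans k0).
have q0 : 0 <= w * b / n%:R by rewrite divr_ge0 ?mulr_ge0 ?(ltW w0) ?(ltW b0) ?(ltW n0).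
have qp : w * b / n%:R <= w * a / n%:R.
  by rewrite ler_pM2r ?invr_gt0 // ler_pM2l // ltW.
have p01 : 0 <= w * a / n%:R <= 1 by rewrite wa andbT (le_trans q0).
have q01 : 0 <= w * b / n%:R <= 1 by rewrite q0 (le_trans qp).
have meanM B : mean_edges P (w * a / n%:R) (w * b / n%:R) B <= w * a * n%:R / 2.
  apply: le_trans (_ : \sum_(e in B) (w * a / n%:R) <= _).
    by apply: ler_sum => e _; rewrite /sbm_edge_prob; case: ifP.
  rewrite sumr_const -[leLHS]mulr_natr.
  apply: le_trans (_ : w * a / n%:R * (n%:R ^+ 2 / 2) <= _).
    rewrite ler_wpM2l ?(andP p01).1 //.
    apply: le_trans (_ : ('C(n, 2))%:R <= _).
      rewrite ler_nat -[n in leqRHS]card_ord -cardsT -card_inner.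
      by apply: subset_leq_card; apply/subsetP => e _; rewrite inE subsetT.
    by rewrite natr_bin2 expr2; nra.
  by rewrite [leLHS](_ : _ = w * a * n%:R / 2) //; field; rewrite gt_eqF.
(* This [l] minimizes the exponent [l ^+ 2 * (w a n) - l * (w n r / 4)]. *)
pose l := r / (8 * a).
have l0 : 0 <= l <= 1 / 2.
  rewrite /l divr_ge0 ?mulr_ge0 ?(ltW a0) ?(ltW r0) //= ler_pdivrMr ?mulr_gt0 //.
  by lra.
have := edges_in_concentration p01 q01 (w * n%:R * r / 4) meanM l0.
move=> conc; apply: le_trans (le_trans conc _); last first.
  apply: sbm_prob_le => // G; rewrite -!topredE /= => /forallP good.
  apply/forallP => S; have {}good := good S.
  have := mean_inner_density k0 kn bP S b0 ab w0.
  set m := mean_edges _ _ _ _ in good *.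
  have e1 : (2 * k%:R + 1) * a / n%:R <= r / 2.
    rewrite ler_pdivrMr // mulrAC ler_pdivlMr // mulrC.
    by move: h1; rewrite ler_pdivrMr //; lra.
  have e2 : `|2 * (edges_in G S)%:R / (w * n%:R) - 2 * m / (w * n%:R)| <= r / 2.
    rewrite -mulrBl -mulrBr !normrM ger0_norm // [`|(_)^-1|]ger0_norm; last first.
      by rewrite invr_ge0 mulr_ge0 // ltW.
    rewrite ler_pdivrMr ?mulr_gt0 //; lra.
  move: e2; rewrite !ler_distl => /andP[? ?] /andP[? ?].
  by apply/andP; split; lra.
rewrite lerD2l lerN2.
apply: le_trans (le_trans (_ : _ <= 2 ^+ n * (2 * expR (- (2 * n%:R)))) (expR_decay R n)) _.
  rewrite ler_pM2l ?exprn_gt0 // ler_pM2l // ler_expR.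
  have -> : 2 * l ^+ 2 * (w * a * n%:R / 2) - l * (w * n%:R * r / 4) =
     - (w * r ^+ 2 / (64 * a) * n%:R) by rewrite /l; field; rewrite gt_eqF.
  rewrite lerN2 ler_pM2r // ler_pdivlMr ?mulr_gt0 //.
  by move: wc; rewrite ltr_pdivrMr ?exprn_gt0 //; lra.
rewrite ler_pdivrMr; last by rewrite ltr_pwDl.
by move: h2; rewrite ler_pdivrMr //; nra.
Qed.

(** * The gap in the limit modularity *)

Lemma sum_sqr_le (R : realType) (I : finType) (x : I -> R) :
  (forall i, 0 <= x i) -> \sum_i x i ^+ 2 <= (\sum_i x i) ^+ 2.
Proof.
move=> x0; rewrite expr2 mulr_suml; apply: ler_sum => i _.
by rewrite expr2 ler_wpM2l // (bigD1 i) //= lerDl sumr_ge0.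
Qed.

(** Write [T] for the sum of the squares of the off-diagonal entries, [d] and [r]
for their column and row sums.  Expanding both squares, the excess over
[k ^+ 2 - k - 2 k D] is at most [(k - 1) (T + sum d ^+ 2) + 2 sum r d], using
[T <= sum r ^+ 2].  Then [T <= sum d ^+ 2 <= D ^+ 2] and
[sum r d <= D ^+ 2 - sum d ^+ 2], the latter because mass leaving column [i]
never lands in row [i].  Equality holds when one column sends all of [D] to a
single row. *)
Lemma stochastic_loss (R : realType) (k : nat) (u : 'I_k -> 'I_k -> R) (D : R) :
  (2 <= k)%N -> (forall i j, 0 <= u i j) -> (forall j, \sum_i u i j = 1) ->
  D = \sum_j (1 - u j j) ->
  k%:R * (\sum_i \sum_j u i j ^+ 2) - \sum_i (\sum_j u i j) ^+ 2
    <= k%:R ^+ 2 - k%:R - 2 * (k%:R * D - (k%:R - 1) * D ^+ 2).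
Proof.
move=> k2 u0 u1 DE.
pose v i j : R := if i == j then 0 else u i j.
pose d j : R := 1 - u j j; pose r i : R := \sum_j v i j.
have v0 i j : 0 <= v i j by rewrite /v; case: ifP.
have r0 i : 0 <= r i by apply: sumr_ge0.
have dE j : \sum_i v i j = d j.
  rewrite /d -(u1 j) (bigD1 j) //= [in RHS](bigD1 j) //= /v eqxx add0r.
  by rewrite [RHS]addrAC subrr add0r; apply: eq_bigr => i /negbTE ->.
have d0 j : 0 <= d j by rewrite -dE sumr_ge0.
have rowE i : \sum_j u i j = 1 - d i + r i.
  rewrite /r (bigD1 i) //= [X in _ = _ + X](bigD1 i) //= /v eqxx add0r /d subKr.
  by congr (_ + _); apply: eq_bigr => j; rewrite eq_sym => /negbTE ->.
pose T := \sum_i \sum_j v i j ^+ 2.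
pose Q := \sum_i r i ^+ 2; pose X := \sum_i r i * d i; pose L := \sum_i d i ^+ 2.
have TQ : T <= Q by apply: ler_sum => i _; exact: sum_sqr_le.
have TL : T <= L.
  rewrite /T exchange_big; apply: ler_sum => j _ /=.
  by rewrite -dE; exact: sum_sqr_le.
have LD : L <= D ^+ 2 by rewrite DE; exact: sum_sqr_le.
have sr : \sum_i r i = D by rewrite DE /r exchange_big; apply: eq_bigr => j _; exact: dE.
have XD : X + L <= D ^+ 2.
  rewrite /X /L -big_split [leRHS]expr2 {1}DE mulr_suml; apply: ler_sum => i _ /=.
  rewrite expr2 -mulrDl mulrC ler_wpM2l //.
  have -> : D = \sum_j d j by [].
  rewrite (bigD1 i) //= [leLHS]addrC lerD2l /r (bigD1 i) //= /v eqxx add0r.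
  apply: ler_sum => j; rewrite eq_sym => ji; rewrite -dE (bigD1 i) //=.
  by rewrite /v (negbTE ji) lerDl sumr_ge0 // => l _; case: ifP.
have sqE : \sum_i \sum_j u i j ^+ 2 = k%:R - 2 * D + L + T.
  have -> : \sum_i \sum_j u i j ^+ 2 = \sum_i ((1 - 2 * d i + d i ^+ 2) + \sum_j v i j ^+ 2).
    apply: eq_bigr => i _; rewrite (bigD1 i) //= [X in _ = _ + X](bigD1 i) //=.
    congr (_ + _); first by rewrite /d; ring.
    rewrite /v eqxx expr0n add0r.
    by apply: eq_bigr => j; rewrite eq_sym => /negbTE ->.
  rewrite !big_split /= sumr_const card_ord.
  by rewrite sumrN -mulr_sumr -DE.
have rowsE : \sum_i (\sum_j u i j) ^+ 2 = k%:R + L + Q - 2 * X.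
  have -> : \sum_i (\sum_j u i j) ^+ 2 =
    \sum_i (1 + d i ^+ 2 + r i ^+ 2 - 2 * (r i * d i) - 2 * d i + 2 * r i).
    by apply: eq_bigr => i _; rewrite rowE; ring.
  rewrite !big_split /= sumr_const card_ord !sumrN -!mulr_sumr sr -/Q -/L -/X.
  by rewrite -DE; ring.
have k2' : 2 <= k%:R :> R by rewrite ler_nat.
have h1 : (k%:R - 1) * T <= (k%:R - 1) * L by rewrite ler_wpM2l //; lra.
have h2 : (k%:R - 2) * L <= (k%:R - 2) * D ^+ 2 by rewrite ler_wpM2l //; lra.
rewrite sqE rowsE; lra.
Qed.

Section Gap.
Variables (R : realType) (n k : nat) (P : kpartition n k) (a b : R).
Hypotheses (b0 : 0 < b) (ab : b < a) (k3 : (3 <= k)%N) (kn : (k <= n)%N).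
Hypothesis bP : balanced P.

Let k0 : (0 < k)%N. Proof. exact: leq_trans k3. Qed.
Let n0 : 0 < n%:R :> R. Proof. by rewrite ltr0n (leq_trans k0). Qed.
Let P0 := balanced_gt0 k0 kn bP.
Let kappa0 : 0 < a + (k%:R - 1) * b.
Proof. by have := kappa_gt0 b0 ab k0; rewrite pmulr_lgt0 // invr_gt0 ltr0n. Qed.

(** The permutation attaining the maximum in [dist]; the difference comes from
measuring overlaps relative to [n / k] or to the size of the community. *)
Lemma dist_share_perm (A : kpartition n k) : exists s : {perm 'I_k},
  `|k%:R * dist R A P - \sum_j (1 - share R P (part A (s j)) j)|
    <= k%:R ^+ 2 / n%:R.
Proof.
have S0 : (0 < #|{: {perm 'I_k}}|)%N by apply/card_gt0P; exists 1%g.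
have [s hs] := @bigop.eq_bigmax _ (fun s : {perm 'I_k} => (\sum_(i < k) #|part A (s i) :&: part P i|)%N) S0.
exists s; rewrite /dist hs natr_sum.
have -> : 1 - n%:R^-1 * \sum_(i < k) #|part A (s i) :&: part P i|%:R =
   \sum_j (#|part P j|%:R / n%:R * (1 - share R P (part A (s j)) j)) :> R.
  under [RHS]eq_bigr => j _.
    rewrite (_ : _ * _ = #|part P j|%:R / n%:R - n%:R^-1 * #|part A (s j) :&: part P j|%:R); last first.
      by rewrite /share; field; rewrite !pnatr_eq0 -!lt0n P0 (leq_trans k0 kn).
    over.
  by rewrite sumrB -mulr_sumr -mulr_suml -!natr_sum sum_part divff ?gt_eqF.
rewrite mulr_sumr -sumrB; apply: le_trans (ler_norm_sum _ _ _) _.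
apply: le_trans (_ : \sum_(j < k) (k%:R / n%:R) <= _); last first.
  by rewrite sumr_const card_ord -[leLHS]mulr_natl mulrA expr2.
apply: ler_sum => j _; set u := share _ _ _ _.
have u0 : 0 <= u by exact: share_ge0.
have u1 : u <= 1 by exact: share_le1 P0 _ _.
have -> : k%:R * (#|part P j|%:R / n%:R * (1 - u)) - (1 - u) =
   k%:R * (#|part P j|%:R / n%:R - 1 / k%:R) * (1 - u).
  by field; rewrite !gt_eqF //= ltr0n.
rewrite !normrM [`|1 - u|]ger0_norm ?subr_ge0 // normr_nat.
rewrite -[leRHS]mulr1 ler_pM ?mulr_ge0 ?subr_ge0 //; last by lra.
by rewrite ler_wpM2l // -[leRHS]div1r; exact: balanced_ratio.
Qed.

(** By [stochastic_loss] the value falls short of the bound for merged communities,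
up to the positive prefactor, by [2 (1 - D) ((k - 1) D - 1) / k ^+ 2] with [D]
close to [k dist].  Here [1 - D] is about [1 - k nu] at least, and
[(k - 1) D - 1] is about [k / 2 - 1 >= 1 / 2] at least; the conditions on [n]
ensure half of each. *)
Lemma limit_modularity_gap (A : kpartition n k) (nu : R) :
  k%:R ^+ 2 / n%:R <= 1 / (4 * k%:R) :> R ->
  k%:R ^+ 2 / n%:R <= (1 - k%:R * nu) / 2 ->
  1 / (2 * (k%:R - 1)) < dist R A P < nu ->
  limit_modularity P a b A <=
    (a - b) / (a + (k%:R - 1) * b) *
      (1 - 1 / k%:R - 2 / k%:R ^+ 2 - (1 - k%:R * nu) / (4 * k%:R ^+ 2)).
Proof.
set tau := k%:R ^+ 2 / n%:R => tk tnu /andP[d1 d2].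
have [s] := dist_share_perm A; rewrite -/tau.
set D := \sum_j _ => hD.
rewrite /limit_modularity ler_wpM2l //.
  by rewrite divr_ge0 ?subr_ge0 ?(ltW ab) ?(ltW kappa0).
have permE (F : 'I_k -> R) : \sum_i F (s i) = \sum_i F i.
  by rewrite [RHS](reindex_inj (@perm_inj _ s)).
have col j : \sum_i share R P (part A (s i)) j = 1.
  by rewrite (permE (fun i => share R P (part A i) j)); exact: sum_share P0 _ _.
have := stochastic_loss (ltnW k3) (fun i j => share_ge0 R P _ j) col (erefl D).
rewrite (permE (fun i => \sum_j share R P (part A i) j ^+ 2)).
rewrite (permE (fun i => (\sum_j share R P (part A i) j) ^+ 2)) => loss.
rewrite ler_pdivrMr ?exprn_gt0 ?ltr0n //; apply: le_trans loss _.
have -> : (1 - 1 / k%:R - 2 / k%:R ^+ 2 - (1 - k%:R * nu) / (4 * k%:R ^+ 2)) * k%:R ^+ 2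
  = k%:R ^+ 2 - k%:R - 2 - (1 - k%:R * nu) / 4 :> R.
  by field; rewrite gt_eqF // ltr0n.
have tau0 : 0 <= tau by rewrite divr_ge0 ?sqr_ge0.
have t4 : k%:R * tau <= 1 / 4.
  have -> : 1 / 4 = k%:R * (1 / (4 * k%:R)) :> R by field; rewrite gt_eqF // ltr0n.
  by rewrite ler_pM2l // ltr0n.
have kp : 3 <= k%:R :> R by rewrite ler_nat.
move: d1; rewrite ltr_pdivrMr; last by lra.
move=> d1.
have kd2 : k%:R * dist R A P <= k%:R * nu by rewrite ler_pM2l ?ltr0n // ltW.
move: hD; rewrite ler_distl => /andP[hD1 hD2].
have D1 : (1 - k%:R * nu) / 2 <= 1 - D by lra.
have D2 : 1 / 4 <= (k%:R - 1) * D - 1.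
  have : (k%:R - 1) * (k%:R * dist R A P - tau) <= (k%:R - 1) * D.
    by rewrite ler_wpM2l //; lra.
  have : k%:R / 2 <= k%:R * (dist R A P * (k%:R - 1)).
    by rewrite ler_wpM2l //; lra.
  by lra.
have nu0 : 0 <= (1 - k%:R * nu) / 2 by lra.
have := ler_pM nu0 (_ : 0 <= 1 / 4) D1 D2.
by move=> /(_ ltac:(lra)); lra.
Qed.

Definition merge_parts (i0 i1 : 'I_k) : kpartition n k :=
  [ffun v => if P v == i1 then i0 else P v].

Lemma cap_merge_parts (i0 i1 i j : 'I_k) :
  part (merge_parts i0 i1) i :&: part P j =
  if (if j == i1 then i0 else j) == i then part P j else set0.
Proof.
apply/setP => v; rewrite !inE ffunE; case: (eqVneq (P v) j) => h.
  by rewrite h andbT; case: (_ == i); rewrite !inE ?h ?eqxx.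
by rewrite andbF; case: (_ == i); rewrite !inE ?(negbTE h).
Qed.

(** The share matrix is 0-1 with row sums 2 (at [i0]), 0 (at [i1]) and 1
elsewhere. *)
Lemma limit_modularity_merge_parts (i0 i1 : 'I_k) : i0 != i1 ->
  limit_modularity P a b (merge_parts i0 i1) =
    (a - b) / (a + (k%:R - 1) * b) * (1 - 1 / k%:R - 2 / k%:R ^+ 2).
Proof.
move=> i01; rewrite /limit_modularity; congr (_ * _).
pose m j := if j == i1 then i0 else j.
have sh i j : share R P (part (merge_parts i0 i1) i) j = (m j == i)%:R.
  rewrite /share cap_merge_parts -/(m j); case: ifP => _; last by rewrite cards0 mul0r.
  by rewrite divff // pnatr_eq0 -lt0n P0.
have -> : \sum_i \sum_j share R P (part (merge_parts i0 i1) i) j ^+ 2 = k%:R.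
  rewrite exchange_big -[RHS](_ : \sum_(j < k) 1 = _); last by rewrite sumr_const card_ord.
  apply: eq_bigr => j _; rewrite (bigD1 (m j)) //= sh eqxx expr1n big1 ?addr0 // => i.
  by rewrite eq_sym sh => /negbTE ->; rewrite expr0n.
have row i : \sum_j share R P (part (merge_parts i0 i1) i) j = 1 + (i == i0)%:R - (i == i1)%:R.
  have -> : \sum_j share R P (part (merge_parts i0 i1) i) j =
      \sum_j ((j == i)%:R + (if j == i1 then (i == i0)%:R - (i == i1)%:R else 0)).
    apply: eq_bigr => j _; rewrite sh /m; case: ifP => [/eqP ->|]; rewrite ?addr0 //.
    by rewrite [i1 == i]eq_sym [i0 == i]eq_sym; lra.
  rewrite big_split /= -big_mkcond big_pred1_eq (bigD1 i) //= eqxx big1 ?addr0 ?addrA //.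
  by move=> j /negbTE ->.
have -> : \sum_i (\sum_j share R P (part (merge_parts i0 i1) i) j) ^+ 2 = k%:R + 2.
  have -> : \sum_i (\sum_j share R P (part (merge_parts i0 i1) i) j) ^+ 2 =
     \sum_i (1 + (if i == i0 then 3 else 0) + (if i == i1 then -1 else 0)).
    apply: eq_bigr => i _; rewrite row; case: (i =P i0) => [->|_].
      by rewrite (negbTE i01) mulr1n mulr0n; ring.
    by case: eqP => _; rewrite /= ?mulr1n ?mulr0n; ring.
  by rewrite !big_split /= -!big_mkcond !big_pred1_eq sumr_const card_ord; lra.
by field; rewrite gt_eqF // ltr0n.
Qed.

(** Both communities would have to be matched with part [i0], so any bijection
loses one of them entirely. *)
Lemma dist_merge_parts (i0 i1 : 'I_k) : i0 != i1 ->
  1 / k%:R - 1 / n%:R <= dist R (merge_parts i0 i1) P.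
Proof.
move=> i01; rewrite /dist; set M := (\max_(s : {perm 'I_k}) _)%N.
have hM : (M <= n - n %/ k)%N.
  apply/bigmax_leqP => s _.
  have [i hi] : exists i, part (merge_parts i0 i1) (s i) :&: part P i = set0.
    case: (eqVneq i0 (s i0)) => [h0|h0].
      exists i1; rewrite cap_merge_parts eqxx; case: eqP => // h1.
      by have := i01; rewrite (perm_inj (etrans (esym h0) h1)) eqxx.
    by exists i0; rewrite cap_merge_parts (negbTE i01) (negbTE h0).
  rewrite (bigD1 i) //= hi cards0 add0n.
  have := sum_part P; rewrite (bigD1 i) //=.
  have /forallP/(_ i)/andP[h1 _] := bP.
  have : (\sum_(j < k | j != i) #|part (merge_parts i0 i1) (s j) :&: part P j| <=
     \sum_(j < k | j != i) #|part P j|)%N.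
    by apply: leq_sum => j _; apply: subset_leq_card; exact: subsetIr.
  move=> le e; apply: leq_trans le _.
  by rewrite -(leq_add2r (n %/ k)) subnK ?leq_div // -[leqRHS]e addnC leq_add2r.
have fl : n%:R / k%:R - 1 <= (n %/ k)%:R :> R.
  rewrite lerBlDr ler_pdivrMr ?ltr0n // natr1 -natrM ler_nat.
  exact: ltnW (ltn_ceil n k0).
have {}hM : M%:R <= n%:R - (n %/ k)%:R :> R.
  by rewrite -natrB ?leq_div // ler_nat.
have -> : 1 / k%:R - 1 / n%:R = 1 - n%:R^-1 * (n%:R - (n%:R / k%:R - 1)) :> R.
  by field; rewrite !gt_eqF // ltr0n.
rewrite lerD2l lerN2 ler_pM2l ?invr_gt0 //.
by lra.
Qed.

End Gap.

(** * The forbidden range of distances *)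

Theorem theorem2p2 (R : realType) (a b : R) (k : nat)
    (hb : 0 < b) (hab : b < a) (hk : (3 <= k)%N) (nu : R)
    (hnu : 1 / (2 * (k%:R - 1)) < nu < 1 / k%:R) :
  exists mu : R, 0 < mu /\
  forall eps : R, 0 < eps ->
  exists c : R, 0 < c /\
  exists n0 : nat, forall n : nat, (n0 <= n)%N ->
  forall omega : R, c < omega ->
  forall p q : R, p = omega * a / n%:R -> q = omega * b / n%:R -> p <= 1 ->
  forall P : kpartition n k, balanced P ->
  let threshold : R :=
    (a - b) / (a + (k%:R - 1) * b) * (1 - 1 / k%:R - 2 / k%:R ^+ 2) - mu in
  1 - eps <= sbm_prob P p q (fun G : graph n =>
    [forall A : kpartition n k,
      (threshold <= modularity R A G) ==>
      ((dist R A P <= 1 / (2 * (k%:R - 1))) || (nu <= dist R A P))] &&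
    [exists A : kpartition n k,
      (threshold <= modularity R A G) && (nu <= dist R A P)]).
Proof.
have k0 : (0 < k)%N by apply: leq_trans hk.
have kR : 3 <= k%:R :> R by rewrite ler_nat.
have kp : 0 < k%:R :> R by lra.
move: hnu => /andP[_ nuk].
have knu : 0 < 1 - k%:R * nu.
  by move: nuk; rewrite ltr_pdivlMr //; lra.
have K := kappa_gt0 hb hab k0.
set kappa := (a + (k%:R - 1) * b) / k%:R in K.
have kapa : kappa <= a.
  rewrite ler_pdivrMr //.
  have : 0 <= (k%:R - 1) * (a - b) by rewrite mulr_ge0; lra.
  by lra.
have S0 : 0 < a + (k%:R - 1) * b by move: K; rewrite pmulr_lgt0 // invr_gt0.
pose coef := (a - b) / (a + (k%:R - 1) * b).
have coef0 : 0 < coef by rewrite divr_gt0 ?subr_gt0.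
pose g := coef * ((1 - k%:R * nu) / (4 * k%:R ^+ 2)).
have g0 : 0 < g by rewrite mulr_gt0 // divr_gt0 // mulr_gt0 // exprn_gt0.
(* [g] is the gap; the slack and the approximation error take a third each. *)
exists (g / 3); split; first by rewrite divr_gt0.
move=> eps eps0.
pose r := Num.min (kappa / 2) (g / 3 * kappa / (29 * k%:R)).
have r0 : 0 < r.
  have g3 : 0 < g / 3 by rewrite divr_gt0.
  by rewrite lt_min !divr_gt0 // mulr_gt0.
have r1 : r <= kappa / 2 by rewrite ge_min lexx.
have r2 : k%:R * (29 * r / kappa) <= g / 3.
  have : r <= g / 3 * kappa / (29 * k%:R) by rewrite ge_min lexx orbT.
  rewrite ler_pdivlMr ?mulr_gt0 // => h.
  by rewrite mulrA ler_pdivrMr //; lra.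
have ra : r <= a by lra.
have [c [c0 [n1 conc]]] := density_concentration hb hab k0 r0 ra eps0.
exists c; split=> //.
have [n2 h2] := eventually_ge (4 * k%:R ^+ 3 : R).
have [n3 h3] := eventually_ge (2 * k%:R ^+ 2 / (1 - k%:R * nu)).
have [n4 h4] := eventually_ge (1 / (1 / k%:R - nu)).
exists (k + n1 + n2 + n3 + n4)%N => n hn w wc p q -> -> p1 P bP /=.
have [kn n1n n2n n3n n4n] : [/\ k <= n, n1 <= n, n2 <= n, n3 <= n & n4 <= n]%N.
  by clear -hn; split; lia.
have n0 : 0 < n%:R :> R by rewrite ltr0n (leq_trans k0).
have {}h2 : k%:R ^+ 2 / n%:R <= 1 / (4 * k%:R) :> R.
  have := h2 n n2n.
  by rewrite ler_pdivrMr // mulrAC ler_pdivlMr ?mulr_gt0 //; lra.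
have {}h3 : k%:R ^+ 2 / n%:R <= (1 - k%:R * nu) / 2.
  have := h3 n n3n.
  by rewrite ler_pdivrMr // [leRHS]mulrC ler_pdivrMr //; lra.
have {}h4 : 1 / n%:R <= 1 / k%:R - nu.
  have := h4 n n4n; have : 0 < 1 / k%:R - nu by lra.
  by move=> e; rewrite !ler_pdivrMr // mulrC.
apply: le_trans (conc n n1n w wc p1 P bP) _.
have w0 : 0 < w by apply: lt_trans wc.
have p01 : 0 <= w * a / n%:R <= 1 by rewrite p1 divr_ge0 ?mulr_ge0 ?ltW //; lra.
have q01 : 0 <= w * b / n%:R <= 1.
  rewrite divr_ge0 ?mulr_ge0 ?(ltW w0) ?(ltW hb) //=.
  apply: le_trans p1; rewrite ler_pM2r ?invr_gt0 // ler_pM2l //; lra.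
apply: sbm_prob_le => // G; rewrite -!topredE /= => /forallP close.
have P0 := balanced_gt0 k0 kn bP.
have approx A : `|modularity R A G - limit_modularity P a b A| <= g / 3.
  apply: le_trans r2.
  exact: (modularity_approx hb hab k0 P0 A (mulr_gt0 w0 n0) r1 close).
rewrite -/coef; apply/andP; split.
  apply/forallP => A; apply/implyP => thr; rewrite leNgt [nu <= _]leNgt -negb_and.
  apply/negP => mid.
  have := limit_modularity_gap hb hab hk kn bP h2 h3 mid.
  have := approx A; rewrite ler_distl => /andP[_].
  by rewrite -/coef mulrBr -/g; lra.
pose i0 : 'I_k := Ordinal (leq_trans (isT : 1 <= 3)%N hk).
pose i1 : 'I_k := Ordinal (leq_trans (isT : 2 <= 3)%N hk).
have i01 : i0 != i1 by [].
apply/existsP; exists (merge_parts P i0 i1); apply/andP; split.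
  have := approx (merge_parts P i0 i1); rewrite limit_modularity_merge_parts // ler_distl.
  by rewrite -/coef => /andP[].
by apply: le_trans (dist_merge_parts R hk kn bP i01); lra.
Qed.
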